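(* Let $p$ be an odd prime and let $G$ be a group with $|G|=p^n$ and $|Z(G)|=p^{n-2}$. Then the clique number of the commuting graph $\zeta(G,G)$ is $p^{n-1}$.
   Context: $Z(G)$ is the center of $G$. The commuting graph $\zeta(G,G)$ is the simple graph with vertex set $G$ in which two distinct vertices are adjacent if and only if they commute in $G$. The clique number is the number of vertices in a maximum clique. *)

(* Defs.v *)
From mathcomp Require Import all_boot all_fingroup all_solvable.

Set Implicit Arguments.
Unset Strict Implicit.
Unset Printing Implicit Defensive.

Local Open Scope group_scope.

Record sgraph := SGraph {
  vertex : finType;
  adj : rel vertex;
  adj_sym : symmetric adj;
  adj_irrefl : irreflexive adj }.

Definition clique (g : sgraph) (S : {set vertex g}) : bool :=
  [forall x in S, forall y in S, (x != y) ==> adj x y].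

Definition clique_number (g : sgraph) : nat :=
  \max_(S : {set vertex g} | clique S) #|S|.

Section CommutingGraph.

(* [subg_of G] is the subtype of gT made of the elements of G. *)
Variables (gT : finGroupType) (G : {group gT}).

Definition commuting_adj : rel (subg_of G) :=
  fun x y => (x != y) && (val x * val y == val y * val x).

Lemma commuting_adj_sym : symmetric commuting_adj.
Proof. by move=> x y; rewrite /commuting_adj eq_sym [_ * _ == _]eq_sym. Qed.

Lemma commuting_adj_irrefl : irreflexive commuting_adj.
Proof. by move=> x; rewrite /commuting_adj eqxx. Qed.

Definition commuting_graph : sgraph :=
  SGraph commuting_adj_sym commuting_adj_irrefl.

End CommutingGraph.

(* Main.v *)
(* A clique of the commuting graph generates an abelian subgroup, so the clique
   number is the largest order of an abelian subgroup.  As Z(G) has index p^2,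
   G is not abelian, so abelian subgroups have order at most p^(n-1).  For x in
   G outside Z(G), the abelian group <x> Z(G) lies strictly between Z(G) and G
   and therefore has order exactly p^(n-1). *)
Require Import Defs.
From mathcomp Require Import all_boot all_fingroup all_solvable.

Set Implicit Arguments.
Unset Strict Implicit.
Unset Printing Implicit Defensive.

Local Open Scope group_scope.

Section CommutingCliques.

Variables (gT : finGroupType) (G : {group gT}).

Lemma abelian_gen_clique (S : {set vertex (commuting_graph G)}) :
  clique S -> abelian <<val @: S>>.
Proof.
move=> /forall_inP cliqueS; rewrite abelian_gen.
apply/centsP=> _ /imsetP[x Sx ->] _ /imsetP[y Sy ->].
have [-> // | neq_xy] := eqVneq x y.
have /forall_inP/(_ y Sy) := cliqueS x Sx.
by rewrite neq_xy => /andP[_ /eqP].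
Qed.

(** [subg G] fixes the underlying value only for elements of [G], hence the role of [H \subset G]:
    there [sgval] undoes it, and commutation carries over from [H]. *)
Lemma clique_abelian (H : {group gT}) :
  H \subset G -> abelian H ->
  @clique (commuting_graph G) (subg G @: H).
Proof.
move=> sHG /centsP cHH.
apply/forall_inP=> _ /imsetP[x Hx ->]; apply/forall_inP=> _ /imsetP[y Hy ->].
apply/implyP=> neq_xy; rewrite /= /commuting_adj neq_xy /=.
by rewrite -!/(sgval _) !subgK ?(subsetP sHG) //; apply/eqP/cHH.
Qed.

Lemma clique_number_commuting_leqP (m : nat) :
  reflect (forall H : {group gT}, H \subset G -> abelian H -> #|H| <= m)
          (clique_number (commuting_graph G) <= m).
Proof.
apply: (iffP (bigmax_leqP _ _ _)) => [le_m H sHG cHH | le_m S cliqueS].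
  (* [subg G] is injective on [H], so the clique it produces has exactly [#|H|] vertices. *)
  rewrite -(card_in_imset (can_in_inj (sub_in1 (subsetP sHG) (@subgK _ G)))).
  exact/le_m/clique_abelian.
rewrite -(card_imset _ val_inj).
apply: leq_trans (subset_leq_card (subset_gen _)) _.
apply: le_m (abelian_gen_clique cliqueS).
by rewrite gen_subG; apply/subsetP=> _ /imsetP[x _ ->]; apply: subgP.
Qed.

End CommutingCliques.

(** Lagrange gives a power of [p]; properness makes the exponent drop. *)
Lemma proper_card_pfactor (gT : finGroupType) (H G : {group gT}) (p n : nat) :
  prime p -> #|G| = (p ^ n)%N -> H \proper G ->
  exists2 k, k < n & #|H| = (p ^ k)%N.
Proof.
move=> p_pr oG ltHG; have := cardSg (proper_sub ltHG).
rewrite oG => /(dvdn_pfactor _ _ p_pr)[k _ oH]; exists k => //.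
by rewrite -(ltn_exp2l _ _ (prime_gt1 p_pr)) -oG -oH proper_card.
Qed.

Lemma cycle_join_center_abelian (gT : finGroupType) (G : {group gT}) (x : gT) :
  x \in G -> abelian (<[x]> <*> 'Z(G)).
Proof.
move=> Gx; rewrite abelianY cycle_abelian center_abelian /=.
by rewrite (subset_trans (subsetIr _ _)) // centS // cycle_subG.
Qed.

Local Close Scope group_scope.

Theorem theorem4p2 (gT : finGroupType) (G : {group gT}) (p n : nat)
    (p_pr : prime p) (p_odd : odd p) (n_ge2 : 2 <= n)
    (oG : #|G| = (p ^ n)%N) (oZ : #|'Z(G)%g| = (p ^ (n - 2))%N) :
  clique_number (commuting_graph G) = (p ^ (n - 1))%N.
Proof.
have p_gt1 := prime_gt1 p_pr.
have ltZG: ('Z(G) \proper G)%g.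
  by rewrite properEcard center_sub oZ oG ltn_exp2l // ltn_subrL (ltnW n_ge2).
have not_cGG: ~~ abelian G.
  apply/negP=> cGG; move: ltZG; rewrite properE => /andP[_ /negP[]].
  by rewrite subsetI subxx.
have ltHG (H : {group gT}) : H \subset G -> abelian H -> H \proper G.
  move=> sHG cHH; rewrite properEneq sHG andbT.
  by apply: contraNneq not_cGG => <-.
apply/eqP; rewrite eqn_leq; apply/andP; split.
  apply/clique_number_commuting_leqP => H sHG cHH.
  have [k lt_kn ->] := proper_card_pfactor p_pr oG (ltHG H sHG cHH).
  by rewrite leq_exp2l // leq_subRL ?add1n // (ltnW n_ge2).
have [_ [x Gx notZx]] := properP ltZG.
have cHH := cycle_join_center_abelian Gx.
have sHG: (<[x]> <*> 'Z(G) \subset G)%g.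
  by rewrite join_subG cycle_subG Gx center_sub.
have ltZH: ('Z(G) \proper <[x]> <*> 'Z(G))%g.
  apply/properP; split; first exact: joing_subr.
  by exists x; rewrite // mem_gen // inE cycle_id.
have [k _ oH] := proper_card_pfactor p_pr oG (ltHG _ sHG cHH).
(* Taking the bound [m] to be the clique number itself turns the equivalence into a lower bound: the
   order of [<[x]> <*> 'Z(G)] is at most the clique number. *)
have := elimT (clique_number_commuting_leqP G _) (leqnn _) _ sHG cHH.
(* Strict inclusion of the center gives [n - 2 < k], which is [n - 1 <= k] because [2 <= n] keeps
   the subtraction from truncating. *)
apply: leq_trans; move: (proper_card ltZH); rewrite oZ oH ltn_exp2l // => lt_k.
by rewrite leq_exp2l // -(subnK n_ge2) addn2 subn1.
Qed.
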